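(* Let $n$ be a positive integer and let $Q$ be any $n\times n$ regular rational orthogonal matrix. Then there exists an $n\times n$ permutation matrix $P$ such that $-1$ is not an eigenvalue of $QP$. Moreover, every $n\times n$ regular rational orthogonal matrix $Q$ can be expressed as $Q=(I_n+S)^{-1}(I_n-S)P$ for some rational skew-symmetric $n\times n$ matrix $S$ with $Se=0$ and some $n\times n$ permutation matrix $P$.
   Context: $I_n$ is the identity matrix of order $n$ and $e=(1,1,\dots,1)^{\rm T}$ is the all-one column vector of length $n$. A rational orthogonal matrix is a matrix $Q$ with rational entries such that $Q^{\rm T}Q=I_n$; it is called regular if $Qe=e$ (each row sum equals one). A matrix $S$ is skew-symmetric if $S^{\rm T}=-S$, and rational if all its entries are rational. *)

(* Defs.v *)
From mathcomp Require Import all_boot all_order all_algebra.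

Set Implicit Arguments.
Unset Strict Implicit.
Unset Printing Implicit Defensive.

Import GRing.Theory.
Local Open Scope ring_scope.

Definition ones (n : nat) : 'cV[rat]_n := const_mx 1.

Definition rat_orthogonal (n : nat) (Q : 'M[rat]_n) : Prop :=
  Q^T *m Q = 1%:M.

Definition regular_rat_orthogonal (n : nat) (Q : 'M[rat]_n) : Prop :=
  rat_orthogonal Q /\ Q *m ones n = ones n.

Definition skew_symmetric (n : nat) (S : 'M[rat]_n) : Prop :=
  S^T = - S.

(* Main.v *)
Require Import Defs.
From mathcomp Require Import all_boot all_order all_algebra.
From mathcomp Require Import fingroup perm.

(** Write [e] for the all-one vector.  The idea is to start from an arbitrary
    permutation matrix and to multiply by transpositions, each one strictly
    shrinking the eigenspace of [-1], until that eigenspace is zero.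

    Let [U] be orthogonal with [U e = e], and let [x] be a nonzero eigenvector
    of [U] for [-1].  Since [U] fixes [e], the vector [x] is orthogonal to [e],
    hence not constant: [x_i != x_j] for some [i], [j].  The transposition [T]
    of [i] and [j] is the reflection along [v = e_i - e_j], and [v] is not
    orthogonal to [x].  If [y] is an eigenvector of [U T] for [-1], then
    [y + y U] is on the one hand a multiple of [v], on the other hand
    orthogonal to the eigenspace of [U] for [-1], in particular to [x]; so it
    vanishes, which means that [y] is already an eigenvector of [U], and that
    [y_i = y_j].  The eigenspace of [U T] is therefore contained in that of
    [U] and misses [x] (lemma [rank_1D_tperm]).  A permutation [s] maximizing
    the rank of [1 + Q s] thus makes [1 + Q s] invertible
    (lemma [perm_unit_1D]).

    Once [-1] is not an eigenvalue of [V = Q s], the Cayley transform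
    [S = (1 - V) (1 + V)^-1] is defined; it is skew-symmetric because [V] is
    orthogonal, kills [e] because [V] fixes it, and the transform is an
    involution, which gives [V = (1 + S)^-1 (1 - S)]. *)

Set Implicit Arguments.
Unset Strict Implicit.
Unset Printing Implicit Defensive.

Import GRing.Theory Num.Theory.
Local Open Scope ring_scope.

Lemma eigenvalueN1_unitmx (F : fieldType) n (U : 'M[F]_n) :
  eigenvalue U (-1) = (1%:M + U \notin unitmx).
Proof.
by rewrite /eigenvalue /eigenspace raddfN opprK addrC
  kermx_eq0 row_free_unit.
Qed.

(** A transposition matrix is the reflection along the difference of two basis
    vectors. *)
Lemma subr_mul_tperm (R : pzRingType) n (y : 'rV[R]_n) (i j : 'I_n) :
  y - y *m tperm_mx i j =
  (y 0 i - y 0 j) *: (delta_mx 0 i - delta_mx 0 j).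
Proof.
rewrite -xcolE; apply/rowP => k; rewrite !mxE /=.
case: tpermP => [->|->|/eqP/negPf-> /eqP/negPf->]; last by rewrite !subrr mulr0.
- rewrite eqxx; case: eqVneq => [->|_]; first by rewrite !subrr mulr0.
  by rewrite subr0 mulr1.
- rewrite eqxx; case: eqVneq => [->|_]; first by rewrite !subrr mulr0.
  by rewrite sub0r mulrN1 opprB.
Qed.

Lemma sum_eq0_nonconst (F : numFieldType) n (x : 'rV[F]_n) :
  x *m const_mx 1 = 0 :> 'M_1 -> x != 0 -> exists i j, x 0 i != x 0 j.
Proof.
move=> xe0 x_n0.
have [i xi_n0] : exists i, x 0 i != 0.
  by case/rV0Pn: x_n0 => i; exists i.
exists i; apply/existsP; apply: contraNT xi_n0 => /existsPn x_cst.
have /matrixP/(_ 0 0) := xe0; rewrite !mxE.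
rewrite (eq_bigr (fun=> x 0 i)) => [|j _]; last first.
  by rewrite mxE mulr1; apply/esym/eqP; have := x_cst j; rewrite negbK.
rewrite sumr_const card_ord => /eqP; rewrite mulrn_eq0.
by case/orP=> // /eqP n0; move: (ltn_ord i); rewrite {2}n0.
Qed.

(** If [y U T = - y], then [y + y U = y - y T] is a multiple of the vector [v]
    along which [T] reflects.  It is also orthogonal to [x], because
    orthogonality of [U] makes [x^T] a right eigenvector for [-1].  As [v] is
    not orthogonal to [x], that multiple is zero.  So the kernel of [1 + U T] lies in
    that of [1 + U] and consists of vectors orthogonal to [v], which leaves
    [x] out. *)
Lemma rank_1D_tperm (F : fieldType) n (U : 'M[F]_n) (x : 'rV_n) i j :
  U^T *m U = 1%:M -> x *m U = - x -> x 0 i != x 0 j ->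
  (\rank (1%:M + U)%R < \rank (1%:M + U *m tperm_mx i j)%R)%N.
Proof.
move=> UtU xU xij; set T := tperm_mx i j.
have UxT : U *m x^T = - x^T.
  rewrite -[x in LHS]opprK -xU raddfN /= trmx_mul mulmxN mulmxA.
  by rewrite (mulmx1C UtU) mul1mx.
have TT : T *m T = 1%:M by rewrite /T -perm_mxM tperm2 perm_mx1.
have kerUT (y : 'rV_n) : y *m (1%:M + U *m T) = 0 ->
    y 0 i = y 0 j /\ y *m (1%:M + U) = 0.
  rewrite mulmxDr mulmx1 mulmxA => /eqP; rewrite addr_eq0 => /eqP yUT.
  have yU : y *m U = - (y *m T).
    by rewrite [in RHS]yUT mulNmx opprK -(mulmxA (y *m U)) TT mulmx1.
  have yDU : y *m (1%:M + U) = (y 0 i - y 0 j) *: (delta_mx 0 i - delta_mx 0 j).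
    by rewrite mulmxDr mulmx1 yU subr_mul_tperm.
  suff /eqP yij : y 0 i - y 0 j == 0.
    by rewrite yDU yij scale0r; split=> //; apply/eqP; rewrite -subr_eq0 yij.
  have /matrixP/(_ 0 0) : y *m (1%:M + U) *m x^T = 0.
    by rewrite -mulmxA mulmxDl mul1mx UxT subrr mulmx0.
  rewrite yDU -scalemxAl mulmxBl -!rowE !mxE => /eqP.
  by rewrite mulf_eq0 [X in _ || X]subr_eq0 (negPf xij) orbF.
have : (kermx (1%:M + U *m T) < kermx (1%:M + U))%MS.
  rewrite ltmxE; apply/andP; split.
    apply/row_subP => k; apply/sub_kermxP.
    by case: (kerUT (row k (kermx (1%:M + U *m T))))=> //;
      rewrite -row_mul mulmx_ker row0.
  apply/negP => sKU.
  have /submx_trans/(_ sKU)/sub_kermxP/kerUT[/eqP] :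
      (x <= kermx (1%:M + U))%MS.
    by apply/sub_kermxP; rewrite mulmxDr mulmx1 xU subrr.
  by rewrite (negPf xij).
move/rank_ltmx; rewrite !mxrank_ker => ltK.
by rewrite ltnNge; apply: contraL ltK => leR; rewrite -leqNgt leq_sub2l.
Qed.

(** Maximizing the rank over the finitely many permutations replaces the
    iteration over transpositions. *)
Lemma perm_unit_1D (F : numFieldType) n (Q : 'M[F]_n) :
  Q^T *m Q = 1%:M -> Q *m const_mx 1 = const_mx 1 :> 'cV_n ->
  exists s : 'S_n, 1%:M + Q *m perm_mx s \in unitmx.
Proof.
move=> QtQ Qe.
case: (@arg_maxnP _ (1%g : 'S_n) xpredT
         (fun s => \rank (1%:M + Q *m perm_mx s)%R)) => // s _ max_s.
exists s; set U := Q *m perm_mx s in max_s *.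
have UtU : U^T *m U = 1%:M.
  rewrite /U trmx_mul mulmxA -(mulmxA _ Q^T) QtQ mulmx1.
  by rewrite tr_perm_mx -perm_mxM mulVg perm_mx1.
have Ue : U *m const_mx 1 = const_mx 1 :> 'cV_n.
  by rewrite -mulmxA -row_permE row_perm_const.
rewrite -[_ \in _]negbK -eigenvalueN1_unitmx.
apply/negP => /eigenvalueP[x]; rewrite scaleN1r => xU x_n0.
have xe : x *m const_mx 1 = 0 :> 'M_1.
  have /eqP : x *m const_mx 1 = - (x *m const_mx 1) :> 'M_1.
    by rewrite -{1}Ue mulmxA xU mulNmx.
  rewrite -addr_eq0 -mulr2n -scaler_nat scaler_eq0 pnatr_eq0 /=.
  by move/eqP.
have [i [j xij]] := sum_eq0_nonconst xe x_n0.
have := max_s (s * tperm i j)%g isT.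
by rewrite /= perm_mxM mulmxA leqNgt (rank_1D_tperm UtU xU xij).
Qed.

Definition cayley (R : comUnitRingType) n (V : 'M[R]_n) : 'M[R]_n :=
  (1%:M - V) *m invmx (1%:M + V).

Section Cayley.

Variables (F : numFieldType) (n : nat) (V : 'M[F]_n).
Hypothesis unitV : 1%:M + V \in unitmx.

Lemma cayley_1D : 1%:M + cayley V = 2 *: invmx (1%:M + V).
Proof.
rewrite /cayley -{1}(mulmxV unitV) -mulmxDl addrACA subrr addr0.
by rewrite -mulr2n -scaler_nat -scalemxAl mul1mx.
Qed.

Lemma cayley_1B : 1%:M - cayley V = 2 *: (V *m invmx (1%:M + V)).
Proof.
rewrite /cayley -{1}(mulmxV unitV) -mulmxBl opprB addrC addrA subrK.
by rewrite -mulr2n -scaler_nat -scalemxAl.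
Qed.

Lemma cayley_1D_unit : 1%:M + cayley V \in unitmx.
Proof.
by rewrite cayley_1D unitmxZ ?unitmx_inv // unitfE pnatr_eq0.
Qed.

(** Both [1 + S] and [1 - S] are rational functions of [V], so that everything
    commutes and the common factor [2 (1 + V)^-1] cancels. *)
Lemma cayleyK : invmx (1%:M + cayley V) *m (1%:M - cayley V) = V.
Proof.
have VC : V *m invmx (1%:M + V) = invmx (1%:M + V) *m V.
  apply: (can_inj (mulKmx unitV)); rewrite mulKVmx //.
  by rewrite mulmxA mulmxDl mul1mx -{1}[V]mulmx1 -mulmxDr mulmxK.
by rewrite cayley_1B VC scalemxAl -cayley_1D mulKmx // cayley_1D_unit.
Qed.

(** Once the inverses are cleared, the claim becomes
    [(1 - V)^T (1 + V) = - (1 + V)^T (1 - V)], and both sides expand to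
    [V - V^T] since [V^T V = 1]. *)
Lemma cayley_skew : V^T *m V = 1%:M -> (cayley V)^T = - cayley V.
Proof.
move=> VtV; apply: (can_inj (mulmxK unitV)).
rewrite mulNmx mulmxKV //.
have unitVt : (1%:M + V)^T \in unitmx by rewrite unitmx_tr.
apply: (can_inj (mulKmx unitVt)).
rewrite /cayley trmx_mul trmx_inv !mulmxA mulmxV // mul1mx.
rewrite !linearD linearN /= trmx1.
rewrite !(mulmxDl, mulmxDr, mulNmx, mulmxN, mul1mx, mulmx1) VtV.
by rewrite !opprK [LHS]addrACA [RHS]addrC [V + 1%:M]addrC [- 1%:M - _]addrC.
Qed.

Lemma cayley_ker m (e : 'M_(n, m)) : V *m e = e -> cayley V *m e = 0.
Proof.
move=> Ve.
have -> : e = 2^-1 *: ((1%:M + V) *m e).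
  rewrite mulmxDl mul1mx Ve -mulr2n -scaler_nat scalerA mulVf ?scale1r //.
  by rewrite pnatr_eq0.
rewrite -scalemxAr mulmxA /cayley mulmxKV //.
by rewrite mulmxBl mul1mx Ve subrr scaler0.
Qed.

End Cayley.

Theorem theorem4 (n : nat) (hn : (0 < n)%N) :
  (forall Q : 'M[rat]_n, regular_rat_orthogonal Q ->
     exists P : 'M[rat]_n,
       is_perm_mx P /\ ~~ eigenvalue (Q *m P) (-1))
  /\
  (forall Q : 'M[rat]_n, regular_rat_orthogonal Q ->
     exists S P : 'M[rat]_n,
       [/\ skew_symmetric S,
           S *m ones n = 0,
           is_perm_mx P,
           1%:M + S \in unitmx
         & Q = invmx (1%:M + S) *m (1%:M - S) *m P]).
Proof.
split=> Q [QtQ Qe]; have [s unitV] := perm_unit_1D QtQ Qe.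
  by exists (perm_mx s); rewrite perm_mx_is_perm eigenvalueN1_unitmx unitV.
have permK : perm_mx s *m perm_mx s^-1 = 1%:M :> 'M[rat]_n.
  by rewrite -perm_mxM mulgV perm_mx1.
exists (cayley (Q *m perm_mx s)), (perm_mx s^-1); split.
- apply: cayley_skew => //.
  rewrite trmx_mul mulmxA -(mulmxA _ Q^T) QtQ mulmx1.
  by rewrite tr_perm_mx -perm_mxM mulVg perm_mx1.
- by apply: cayley_ker => //; rewrite -mulmxA -row_permE row_perm_const.
- exact: perm_mx_is_perm.
- exact: cayley_1D_unit.
- by rewrite cayleyK // -mulmxA permK mulmx1.
Qed.
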